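(* Let $G$ be a geometric graph with $n$ vertices that has $\lambda$-low density. Then $G$ has packedness $c \in \mathcal{O}(\lambda\sqrt{n})$. That is, there is an absolute constant $C>0$ such that for every $n$, every $\lambda$, and every geometric graph $G$ with $n$ vertices and $\lambda$-low density, $G$ is $c$-packed for $c = C\lambda\sqrt{n}$.
   Context: A geometric graph is a finite simple undirected graph embedded in the plane: each vertex is associated with a point in $\mathbb{R}^2$, each edge is a straight-line segment between its endpoints and has its Euclidean length; edges may cross. Squares are axis-aligned, and the radius of a square is half its side length. A geometric graph $G$ has $\lambda$-low density if for each square $S$ of radius $r$ (for every $r>0$) there are at most $\lambda$ edges of $G$ that have length greater than $r$ and intersect $S$. A geometric graph $G$ is $c$-packed (has packedness $c$) if for each square $S$ of radius $r$ (for every $r>0$) the total length of the edges of $G$ clipped to $S$ is at most $cr$. Both notions can also be defined with balls of radius $r$ instead of squares; the variants are equivalent up to constant factors. *)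

(* Defs.v *)
From HB Require Import structures.
From mathcomp Require Import all_boot all_order all_algebra.
From mathcomp Require Import all_classical all_reals all_analysis.

Set Implicit Arguments.
Unset Strict Implicit.
Unset Printing Implicit Defensive.

Import Order.TTheory GRing.Theory Num.Theory.
Import numFieldNormedType.Exports.

Local Open Scope classical_set_scope.
Local Open Scope ring_scope.

(* The position map is not required to be injective, and edges may cross or
   overlap. *)
Record geometric_graph (R : realType) (V : finType) := GeometricGraph {
  pos : V -> 'rV[R]_2 ;
  adj : rel V ;
  adj_sym : symmetric adj ;
  adj_irrefl : irreflexive adj }.

(* Each undirected edge {u, v} is represented exactly once, by the pair whose
   components are increasing in the enumeration of V. *)
Definition edges (R : realType) (V : finType) (G : geometric_graph R V) :
    {set V * V} :=
  [set e : V * V | adj G e.1 e.2 & (enum_rank e.1 < enum_rank e.2)%N]%SET.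

Definition eucl_dist (R : realType) (p q : 'rV[R]_2) : R :=
  Num.sqrt (\sum_(i < 2) (p 0 i - q 0 i) ^+ 2).

Definition seg_point (R : realType) (p q : 'rV[R]_2) (t : R) : 'rV[R]_2 :=
  p + t *: (q - p).

Definition segment (R : realType) (p q : 'rV[R]_2) : set 'rV[R]_2 :=
  [set seg_point p q t | t in `[0, 1]].

Definition square (R : realType) (c : 'rV[R]_2) (r : R) : set 'rV[R]_2 :=
  [set x | forall i : 'I_2, `|x 0 i - c 0 i| <= r].

(* Length of the part of the segment pq inside S: the segment is traversed at
   constant speed |pq|, so this is |pq| times the measure of the parameters
   spent in S. *)
Definition clipped_length (R : realType) (p q : 'rV[R]_2)
    (S : set 'rV[R]_2) : \bar R :=
  ((eucl_dist p q)%:E *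
   lebesgue_measure [set t : R | (0 <= t <= 1)%R /\ S (seg_point p q t)])%E.

Definition low_density (R : realType) (V : finType) (lambda : R)
    (G : geometric_graph R V) : Prop :=
  forall (c : 'rV[R]_2) (r : R), 0 < r ->
    #|[set e in edges G | (r < eucl_dist (pos G e.1) (pos G e.2))
        && `[< segment (pos G e.1) (pos G e.2) `&` square c r !=set0 >]]%SET|%:R
    <= lambda.

Definition packed (R : realType) (V : finType) (k : R)
    (G : geometric_graph R V) : Prop :=
  forall (c : 'rV[R]_2) (r : R), 0 < r ->
    (\sum_(e in edges G)
       clipped_length (pos G e.1) (pos G e.2) (square c r) <= (k * r)%:E)%E.

(* Main.v *)
(* Let m be of order sqrt n and cut a square of radius r into m^2 squares of
   radius r / m. A small enough square around a vertex shows that every vertex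
   has at most lambda incident edges of positive length, so at most n lambda
   edges contribute; those of length at most r / m have total length at most
   n lambda r / m. Each of the m^2 small squares meets at most lambda longer
   edges and clips each of them to length O(r / m), for a total of
   O(m lambda r). *)

Require Import Defs.
From mathcomp Require Import all_boot all_order all_algebra.
From mathcomp Require Import all_classical all_reals all_analysis.
From mathcomp Require Import ring lra.

Set Implicit Arguments.
Unset Strict Implicit.
Unset Printing Implicit Defensive.

Import Order.TTheory GRing.Theory Num.Theory.
Import numFieldNormedType.Exports.

Local Open Scope ring_scope.

(** * Elementary bounds and the subdivision of a square into a grid *)

Lemma finite_positive_lower_bound (R : realType) (T : finType) (f : T -> R) :
  exists2 r : R, 0 < r & forall x, 0 < f x -> r < f x.
Proof.
(* The default 1 keeps [m] positive even if [f] has no positive value; halving makes the bound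
   strict. *)
pose m := \big[Order.min/1]_(x | 0 < f x) f x.
have m0 : 0 < m by rewrite /m; elim/big_ind: _ => // a b a0 b0; rewrite lt_min a0.
exists (m / 2) => [|x fx0]; first by rewrite divr_gt0.
have : m <= f x by exact: bigmin_le_cond.
by move: m0; lra.
Qed.

Lemma nat_unit_interval_cover (R : realType) (m : nat) (y : R) :
  (0 < m)%N -> 0 <= y <= m%:R -> exists i : 'I_m, i%:R <= y <= i%:R + 1.
Proof.
case: m => // m _; elim: m => [|m IH] /andP[y0 ym].
  by exists ord0; rewrite y0 add0r.
have [ym1|ym1] := leP y m.+1%:R.
  have /IH[i hi] : 0 <= y <= m.+1%:R by rewrite y0.
  by exists (widen_ord (leqnSn _) i).
by exists ord_max; rewrite (ltW ym1) /= -natr1 in ym *.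
Qed.

Lemma ord2_cases (i : 'I_2) : i = 0 \/ i = 1.
Proof. by case: i => -[|[|//]] p; [left|right]; exact: val_inj. Qed.

(** Cells have radius [r / m], so in each coordinate the centres lie at odd multiples of [r / m]
    from the lower side of the large square. *)
Definition grid_center (R : realType) (c : 'rV[R]_2) (r : R) (m : nat)
    (k : 'I_m * 'I_m) : 'rV[R]_2 :=
  \row_i (c 0 i - r + (2 * (if i == 0 then k.1 else k.2)%:R + 1) * (r / m%:R)).

Lemma square_grid_cover (R : realType) (c x : 'rV[R]_2) (r : R) (m : nat) :
  0 < r -> (0 < m)%N -> square c r x ->
  exists k : 'I_m * 'I_m, square (grid_center c r k) (r / m%:R) x.
Proof.
move=> r0 m0 xS.
have mR0 : 0 < m%:R :> R by rewrite ltr0n.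
have rmE : r = r / m%:R * m%:R by rewrite divfK ?gt_eqF.
have s0 : 0 < r / m%:R by rewrite divr_gt0.
have s20 : 0 < 2 * (r / m%:R) by rewrite mulr_gt0.
have cover1 (i : 'I_2) : exists j : 'I_m,
    `|x 0 i - (c 0 i - r + (2 * j%:R + 1) * (r / m%:R))| <= r / m%:R.
  have := xS i; rewrite ler_norml => /andP[lo hi].
  (* Measured in cell sides [2 * (r / m)], the offset from the lower side lies in [0, m]; the unit
     interval containing it gives the cell index. *)
  have [|j /andP[jlo jhi]] :=
      @nat_unit_interval_cover R m ((x 0 i - c 0 i + r) / (2 * (r / m%:R))) m0.
    apply/andP; split; first by rewrite divr_ge0 ?mulr_ge0 ?(ltW s0)//; lra.
    by rewrite ler_pdivrMr// mulrCA [m%:R * _]mulrC -rmE; lra.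
  exists j; move: jlo jhi.
  rewrite ler_pdivlMr// ler_pdivrMr// ler_norml.
  by move: (r / m%:R) => s jlo jhi; apply/andP; split; nra.
have [j0 h0] := cover1 0; have [j1 h1] := cover1 1.
exists (j0, j1) => i; rewrite !mxE /=.
by case: (ord2_cases i) => ->.
Qed.

(** * Length of a segment clipped to a square *)

Section Clipping.
Context (R : realType) (p q : 'rV[R]_2).
Local Open Scope classical_set_scope.

Let params (S : set 'rV[R]_2) :=
  [set t : R | (0 <= t <= 1)%R /\ S (seg_point p q t)].

Lemma eucl_dist_ge0 : 0 <= eucl_dist p q.
Proof. exact: sqrtr_ge0. Qed.

(** The dominant coordinate works. The sharp factor would be the square root of 2; the cruder 2 is
    enough here. *)
Lemma eucl_dist_le_coord :
  exists i : 'I_2, eucl_dist p q <= 2 * `|q 0 i - p 0 i|.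
Proof.
have dist_le (D : R) : (forall i, `|q 0 i - p 0 i| <= D) ->
    eucl_dist p q <= 2 * D.
  move=> hD; have D0 : 0 <= D := le_trans (normr_ge0 _) (hD 0).
  rewrite -(ger0_norm (mulr_ge0 _ D0))// -sqrtr_sqr ler_wsqrtr//.
  rewrite !big_ord_recl big_ord0 addr0 -[(p _ _ - _) ^+ 2]real_normK ?num_real//.
  rewrite -[X in _ + X]real_normK ?num_real// ![`|p _ _ - _|]distrC.
  have := hD ord0; have := hD (lift ord0 ord0).
  move: (normr_ge0 (q 0 ord0 - p 0 ord0)).
  move: (normr_ge0 (q 0 (lift ord0 ord0) - p 0 (lift ord0 ord0))).
  by move: `|_| `|_| => a b; nra.
have [le01|/ltW le10] := leP `|q 0 0 - p 0 0| `|q 0 1 - p 0 1|.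
  by exists 1; apply: dist_le => i; case: (ord2_cases i) => ->.
by exists 0; apply: dist_le => i; case: (ord2_cases i) => ->.
Qed.

(** Coordinates are affine in [t], so the set is [0, 1] cut by preimages of closed intervals under
    measurable maps. *)
Lemma measurable_params_square (c : 'rV[R]_2) (r : R) :
  measurable (params (square c r)).
Proof.
have -> : params (square c r) = `[0, 1] `&`
    \bigcap_(i in [set: 'I_2])
      (fun t : R => p 0 i + t * (q 0 i - p 0 i)) @^-1` `[c 0 i - r, c 0 i + r].
  apply/seteqP; split => t /=.
    move=> [t01 tS]; split; first by rewrite in_itv.
    move=> i _ /=; have := tS i.
    by rewrite !mxE in_itv /= ler_distl.
  rewrite in_itv /= => -[t01 tS]; split=> // i.
  by have := tS i I; rewrite /= !mxE in_itv /= ler_distl.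
apply: measurableI; first exact: measurable_itv.
apply: fin_bigcap_measurable => // i _.
rewrite -[X in measurable X]setTI.
have mf : measurable_fun setT (fun t : R => p 0 i + t * (q 0 i - p 0 i)).
  apply: measurable_realfun.measurable_funD => //.
  exact: measurable_realfun.mulrr_measurable.
exact: mf.
Qed.

Lemma clipped_length_ge0 (S : set 'rV[R]_2) :
  (0 <= clipped_length p q S)%E.
Proof. by rewrite mule_ge0 ?lee_fin ?eucl_dist_ge0. Qed.

Lemma clipped_length_le_dist (c : 'rV[R]_2) (r : R) :
  (clipped_length p q (square c r) <= (eucl_dist p q)%:E)%E.
Proof.
rewrite -[leRHS]mule1 lee_wpmul2l ?lee_fin ?eucl_dist_ge0//.
have -> : 1%E = lebesgue_measure (`[0, 1] : set R).
  by rewrite lebesgue_measure_itv/= lte_fin ltr01 sube0.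
rewrite le_measure ?inE//; first exact: measurable_params_square.
by move=> t [t01 _] /=; rewrite in_itv.
Qed.

Lemma clipped_length_disjoint (S : set 'rV[R]_2) :
  ~ (segment p q `&` S !=set0) -> clipped_length p q S = 0%E.
Proof.
move=> disj; rewrite /clipped_length (_ : [set t | _] = set0) ?measure0 ?mule0//.
rewrite -subset0 => t [t01 tS]; apply: disj; exists (seg_point p q t).
by split=> //; exists t => //=; rewrite in_itv.
Qed.

(* Along the dominant coordinate the segment crosses the square within a
   parameter interval of length 2r / |q_i - p_i|. *)
Lemma clipped_length_le_radius (c : 'rV[R]_2) (r : R) : 0 < r ->
  (clipped_length p q (square c r) <= (4 * r)%:E)%E.
Proof.
move=> r0; have [i hi] := eucl_dist_le_coord.
(* If the dominant difference vanishes, the segment is a single point and has length 0. *)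
have [d0|d0] := eqVneq (q 0 i - p 0 i) 0.
  apply: (le_trans (clipped_length_le_dist _ _)).
  by rewrite lee_fin (le_trans hi)// d0 normr0 mulr0 mulr_ge0// ltW.
have nd0 : 0 < `|q 0 i - p 0 i| by rewrite normr_gt0.
pose x := (c 0 i - p 0 i) / (q 0 i - p 0 i); pose w := r / `|q 0 i - p 0 i|.
have w0 : 0 < w by rewrite divr_gt0.
have mu_le : (lebesgue_measure (params (square c r)) <= (2 * w)%:E)%E.
  have -> : (2 * w)%:E = lebesgue_measure (`[x - w, x + w] : set R).
    rewrite lebesgue_measure_itv/= lte_fin ifT; last lra.
    by rewrite -EFinB; congr EFin; lra.
  rewrite le_measure ?inE//; first exact: measurable_params_square.
  move=> t [_ /(_ i)]; rewrite !mxE /= in_itv /= -ler_distl => ht.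
  rewrite ler_pdivlMr// -normrM (le_trans _ ht)// le_eqVlt.
  by apply/orP; left; apply/eqP; congr `|_|; rewrite /x mulrBl divfK//; lra.
apply: (@le_trans _ _ ((eucl_dist p q)%:E * (2 * w)%:E)%E).
  by rewrite lee_wpmul2l ?lee_fin ?eucl_dist_ge0.
rewrite -EFinM lee_fin (@le_trans _ _ (2 * `|q 0 i - p 0 i| * (2 * w)))//.
  by rewrite ler_wpM2r// mulr_ge0 ?ltW.
by rewrite mulrACA /w [_ * (r / _)]mulrC divfK ?gt_eqF//; lra.
Qed.

(** Subadditivity of the measure on parameter sets. Cells share boundaries, which is harmless for an
    upper bound. *)
Lemma clipped_length_le_grid (c : 'rV[R]_2) (r : R) (m : nat) :
  0 < r -> (0 < m)%N ->
  (clipped_length p q (square c r) <=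
   \sum_(k : 'I_m * 'I_m)
     clipped_length p q (square (grid_center c r k) (r / m%:R)))%E.
Proof.
move=> r0 m0; rewrite -ge0_sume_distrr => [|k _]; last exact: measure_ge0.
rewrite lee_wpmul2l ?lee_fin ?eucl_dist_ge0//.
rewrite bigfs ?index_enum_uniq// => [|k _]; last by rewrite mem_index_enum.
apply: content_sub_fsum; first exact: finite_finpred.
- by move=> k _; exact: measurable_params_square.
- exact: measurable_params_square.
- by move=> t [t01 /(square_grid_cover r0 m0)[k tk]]; exists k.
Qed.

End Clipping.

Lemma sume_le_card (R : realType) (T : finType) (A B : {set T})
    (f : T -> \bar R) (x k : R) :
  (forall e, e \in A -> e \notin B -> f e = 0%E) ->
  (forall e, e \in A -> e \in B -> (f e <= x%:E)%E) ->
  0 <= x -> #|B|%:R <= k -> (\sum_(e in A) f e <= (k * x)%:E)%E.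
Proof.
move=> f0 fx x0 Bk.
rewrite (bigID (mem B)) /= [X in (_ + X)%E]big1 ?adde0; last first.
  by move=> e /andP[]; exact: f0.
(* [B] may exceed [A]: the extra terms only add copies of [x], which is nonnegative. *)
apply: (@le_trans _ _ (\sum_(e in B) x%:E)%E).
  rewrite [leRHS](bigID (mem A)) /= -[leLHS]adde0 leeD//.
    rewrite (eq_bigl (fun e => (e \in B) && (e \in A))); last first.
      by move=> e; rewrite andbC.
    by apply: lee_sum => e /andP[eB eA]; exact: fx.
  by apply: sume_ge0 => e _; rewrite lee_fin.
by rewrite sumEFin lee_fin sumr_const -mulr_natl ler_wpM2r.
Qed.

(** * Edge counts and clipped lengths under low density *)

Section LowDensity.
Context (R : realType) (V : finType) (G : geometric_graph R V) (lambda : R).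
Hypothesis G_low : low_density lambda G.

Let len (e : V * V) := eucl_dist (pos G e.1) (pos G e.2).

Lemma low_density_ge0 : 0 <= lambda.
Proof. exact: le_trans (G_low 0 ltr01). Qed.

(** Take a square centred at [v] whose radius is below every positive edge length. Counting only
    edges with first component [v] suffices, since each edge is stored once and is charged to that
    endpoint. *)
Lemma low_density_degree (v : V) :
  #|[set e in edges G | (0 < len e) && (e.1 == v)]%SET|%:R <= lambda.
Proof.
have [r r0 rlt] := finite_positive_lower_bound len.
apply: le_trans (G_low (pos G v) r0); rewrite ler_nat subset_leq_card//.
apply/fintype.subsetP => e; rewrite !inE => /andP[-> /andP[e0 /eqP ev]].
rewrite rlt//=; apply/asboolP; exists (pos G v); split.
  by exists 0; rewrite ?ev /seg_point ?scale0r ?addr0//= in_itv /= lexx ler01.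
by move=> i; rewrite subrr normr0 ltW.
Qed.

Lemma low_density_edges :
  #|[set e in edges G | 0 < len e]%SET|%:R <= #|V|%:R * lambda.
Proof.
rewrite -sum1_card (partition_big fst xpredT)//= natr_sum mulr_natl -sumr_const.
apply: ler_sum => v _; apply: le_trans (low_density_degree v).
rewrite sum1_card ler_nat subset_leq_card//.
by apply/fintype.subsetP => e; rewrite [in X in X -> _]unfold_in !inE -andbA.
Qed.

(** Edges of length 0 escape the edge count, as positions may coincide, but they contribute nothing;
    any other edge here contributes at most its length. *)
Lemma low_density_short_edges (c : 'rV[R]_2) (r s : R) : 0 <= s ->
  (\sum_(e in edges G | (len e <= s)%R)
     clipped_length (pos G e.1) (pos G e.2) (square c r)
   <= (#|V|%:R * lambda * s)%:E)%E.
Proof.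
move=> s0.
rewrite (eq_bigl [in [set e in edges G | len e <= s]%SET]); last first.
  by move=> e; rewrite inE.
apply: sume_le_card low_density_edges => // e; rewrite !inE.
  move=> /andP[-> _]; rewrite -leNgt => len0; apply/eqP.
  by rewrite eq_le clipped_length_ge0 (le_trans (clipped_length_le_dist _ _ _ _)).
by move=> /andP[_ les] _; rewrite (le_trans (clipped_length_le_dist _ _ _ _)).
Qed.

(** The length threshold equals the radius, so low density bounds the number of edges meeting the
    square; the others contribute 0. *)
Lemma low_density_long_edges (c : 'rV[R]_2) (s : R) : 0 < s ->
  (\sum_(e in edges G | (s < len e)%R)
     clipped_length (pos G e.1) (pos G e.2) (square c s)
   <= (lambda * (4 * s))%:E)%E.
Proof.
move=> s0.
rewrite (eq_bigl [in [set e in edges G | s < len e]%SET]); last first.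
  by move=> e; rewrite inE.
apply: sume_le_card (G_low c s0).
- move=> e; rewrite !inE => /andP[-> ->] /= /asboolPn.
  exact: clipped_length_disjoint.
- by move=> e _ _; exact: clipped_length_le_radius.
- by rewrite mulr_ge0 ?ltW.
Qed.

Lemma low_density_clipped_sum (c : 'rV[R]_2) (r : R) (m : nat) :
  0 < r -> (0 < m)%N ->
  (\sum_(e in edges G) clipped_length (pos G e.1) (pos G e.2) (square c r)
   <= (#|V|%:R * lambda * (r / m%:R) + 4 * lambda * r * m%:R)%:E)%E.
Proof.
move=> r0 m0; have mR0 : 0 < m%:R :> R by rewrite ltr0n.
have s0 : 0 < r / m%:R by rewrite divr_gt0.
rewrite (bigID (fun e => len e <= r / m%:R)) /= EFinD leeD//.
  by apply: low_density_short_edges; rewrite ltW.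
under eq_bigl do rewrite -ltNge.
apply: (@le_trans _ _ (\sum_(e in edges G | (r / m%:R < len e)%R)
    \sum_(k : 'I_m * 'I_m) clipped_length (pos G e.1) (pos G e.2)
      (square (grid_center c r k) (r / m%:R)))%E).
  by apply: lee_sum => e _; exact: clipped_length_le_grid.
(* Summing over cells first lets the long-edge bound apply to each of the [m * m] cells. *)
rewrite exchange_big /=.
apply: (@le_trans _ _ (\sum_(k : 'I_m * 'I_m) (lambda * (4 * (r / m%:R)))%:E)%E).
  by apply: lee_sum => k _; exact: low_density_long_edges.
rewrite sumEFin lee_fin sumr_const card_prod card_ord -[_ *+ (m * m)]mulr_natl natrM.
by rewrite le_eqVlt; apply/orP; left; apply/eqP; field; rewrite gt_eqF.
Qed.

End LowDensity.

Theorem lemma3 (R : realType) :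
  exists C : R, 0 < C /\
    forall (n : nat) (lambda : R) (V : finType) (G : geometric_graph R V),
      #|V| = n -> low_density lambda G ->
      packed (C * lambda * Num.sqrt n%:R) G.
Proof.
(* 9 = 1 + 4 * 2: short edges cost 1, and the term 4 [m] costs 8 because [m] is at most twice the
   root of [n]. *)
exists 9; split=> // n lambda V G Vn G_low c r r0.
(* Without vertices there are no edges; otherwise the root [q] of [n] is at least 1. *)
have [n0|n0] := posnP n.
  rewrite big1 ?lee_fin ?n0 ?sqrtr0 ?mulr0 ?mul0r// => e _.
  by have := fintype0 e.1; rewrite Vn.
set q := Num.sqrt _; have q0 : 0 <= q by exact: sqrtr_ge0.
have q1 : 1 <= q by rewrite -sqrtr1 ler_wsqrtr// ler1n.
have nE : n%:R = q * q :> R by rewrite -expr2 sqr_sqrtr.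
have /andP[trlo trhi] := truncn_itv q0.
(* The successor gives [q < m], hence [n / m <= q], while [m <= q + 1 <= 2 * q]. *)
set m := (Num.truncn q).+1 in trhi.
have mle : m%:R <= 2 * q by rewrite /m -natr1; lra.
apply: (le_trans (low_density_clipped_sum G_low c r0 (ltn0Sn _ : (0 < m)%N))).
have lam0 : 0 <= lambda := low_density_ge0 G_low.
have lr0 : 0 <= lambda * r by rewrite mulr_ge0 // ltW.
have mR0 : 0 < m%:R :> R by rewrite ltr0n.
rewrite lee_fin Vn nE.
have -> : 9 * lambda * q * r = q * (lambda * r) + 4 * (lambda * r) * (2 * q).
  by ring.
rewrite lerD//.
  rewrite mulrA ler_pdivrMr// (_ : _ * r = q * (lambda * r) * q); last by ring.
  by rewrite ler_wpM2l ?mulr_ge0// ltW.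
by rewrite -[4 * lambda * r]mulrA; apply: ler_wpM2l mle; rewrite mulr_ge0.
Qed.
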